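(* Let $\langle \ell, p\rangle$ be a problem with agent set $N=\{1,\dots,n\}$, let $x^*\in X$ be the efficient profile, i.e. $\mathbb{C}(x^* )\le \mathbb{C}(x)$ for all $x\in X$, and let $\phi^*$ be the solution defined from $x^*$ by \[ \phi^*(i,i)=\ell_i+\sum_{k>i}\Big(\prod_{i<j\le k}p_j(x^*_j)\Big)\ell_k \quad (i\in N),\qquad \phi^*(i,j)=(1-p_j(x^*_j))\,\phi^*(j,j)\quad (i<j), \] and $\phi^*(i,j)=0$ for $j<i$. Then a solution $\phi$ satisfies independent indirect liabilities and implements $x^*$ if and only if $\phi=\phi^*$.
   Context: Agents: $N=\{1,\dots,n\}$, ordered. A problem $\langle \ell,p\rangle$ consists of losses $\ell=(\ell_1,\dots,\ell_n)\in\mathbb{R}^n_{>0}$ and technologies $p=(p_i)_{i\in N}$, where each $p_i:\mathbb{R}_{\ge 0}\to[0,1]$ is strictly increasing, strictly concave, continuous on $[0,\infty)$ and differentiable on $(0,\infty)$, with $p_i(0)=0$ and $p_i'(x_i)\to\infty$ as $x_i\to 0$. A profile is $x=(x_i)_{i\in N}\in X=\mathbb{R}^n_{\ge 0}$. A solution is a function $\phi:N\times N\to\mathbb{R}_{\ge 0}$ with $\phi(i,j)=0$ for all $j<i$ and (balance) $\sum_{j\ge i}\phi(i,j)=\sum_{j\ge i}\ell_j$ for all $i\in N$. It satisfies independent indirect liabilities if $\phi(i,k)=\phi(j,k)$ for all $i<j<k$ in $N$. Given $\phi$, the expected cost of agent $k$ at profile $x$ is \[ C_k(x;\phi)=\sum_{j<k}\Big(\prod_{i<j}p_i(x_i)\Big)(1-p_j(x_j))\,\phi(j,k)+\Big(\prod_{i<k}p_i(x_i)\Big)(1-p_k(x_k))\,\phi(k,k)+x_k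 \] (empty sums are $0$, empty products are $1$). The solution $\phi$ induces the simultaneous-move game in which each agent $k$ chooses $x_k\in\mathbb{R}_{\ge 0}$ to minimize $C_k(\cdot;\phi)$. The solution $\phi$ implements a profile $x$ if $x$ is the unique (pure-strategy) Nash equilibrium of this game. The total cost is $\mathbb{C}(x)=\sum_{j\in N}\big(1-\prod_{i\le j}p_i(x_i)\big)\ell_j+\sum_{j\in N}x_j$. *)

(* Defs.v *)
From mathcomp Require Import all_boot all_order all_algebra.
From mathcomp Require Import boolp classical_sets reals topology normedtype derive.

Set Implicit Arguments.
Unset Strict Implicit.
Unset Printing Implicit Defensive.
Import Order.TTheory GRing.Theory Num.Theory.
Import numFieldNormedType.Exports.
Local Open Scope classical_set_scope.
Local Open Scope ring_scope.

(* A technology [0, oo) -> [0, 1] is a total function R -> R whose values at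
   negative arguments are unconstrained and never used. *)
Record is_technology (R : realType) (f : R -> R) : Prop := IsTechnology {
  tech_range : forall x : R, 0 <= x -> 0 <= f x <= 1 ;
  tech_increasing : forall x y : R, 0 <= x -> x < y -> f x < f y ;
  tech_strictly_concave : forall x y t : R, 0 <= x -> 0 <= y -> x != y ->
    0 < t < 1 -> t * f x + (1 - t) * f y < f (t * x + (1 - t) * y) ;
  tech_continuous : {within [set x : R | 0 <= x], continuous f} ;
  tech_derivable : forall x : R, 0 < x -> derivable f x 1 ;
  tech_at0 : f 0 = 0 ;
  tech_derive_at0 : (f^`())%classic x @[x --> (0:R)^'+] --> +oo }.

Record is_problem (R : realType) (n : nat)
    (ell : 'I_n -> R) (p : 'I_n -> R -> R) : Prop := IsProblem {
  problem_loss_gt0 : forall i, 0 < ell i ;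
  problem_technology : forall i, is_technology (p i) }.

Definition is_profile (R : realType) (n : nat) (x : 'I_n -> R) : Prop :=
  forall i, 0 <= x i.

Record is_solution (R : realType) (n : nat)
    (ell : 'I_n -> R) (phi : 'I_n -> 'I_n -> R) : Prop := IsSolution {
  solution_ge0 : forall i j, 0 <= phi i j ;
  solution_upstream : forall i j : 'I_n, (j < i)%N -> phi i j = 0 ;
  solution_balance : forall i : 'I_n,
    \sum_(j < n | (i <= j)%N) phi i j = \sum_(j < n | (i <= j)%N) ell j }.

Definition independent_indirect_liabilities (R : realType) (n : nat)
    (phi : 'I_n -> 'I_n -> R) : Prop :=
  forall i j k : 'I_n, (i < j)%N -> (j < k)%N -> phi i k = phi j k.

Definition expected_cost (R : realType) (n : nat) (p : 'I_n -> R -> R)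
    (phi : 'I_n -> 'I_n -> R) (k : 'I_n) (x : 'I_n -> R) : R :=
  \sum_(j < n | (j < k)%N)
      (\prod_(i < n | (i < j)%N) p i (x i)) * (1 - p j (x j)) * phi j k
  + (\prod_(i < n | (i < k)%N) p i (x i)) * (1 - p k (x k)) * phi k k
  + x k.

Definition is_nash (R : realType) (n : nat) (p : 'I_n -> R -> R)
    (phi : 'I_n -> 'I_n -> R) (x : 'I_n -> R) : Prop :=
  is_profile x /\
  forall (k : 'I_n) (y : R), 0 <= y ->
    expected_cost p phi k x <= expected_cost p phi k [eta x with k |-> y].

Definition implements (R : realType) (n : nat) (p : 'I_n -> R -> R)
    (phi : 'I_n -> 'I_n -> R) (x : 'I_n -> R) : Prop :=
  unique (is_nash p phi) x.

Definition total_cost (R : realType) (n : nat) (ell : 'I_n -> R)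
    (p : 'I_n -> R -> R) (x : 'I_n -> R) : R :=
  \sum_(j < n) (1 - \prod_(i < n | (i <= j)%N) p i (x i)) * ell j
  + \sum_(j < n) x j.

Definition is_efficient (R : realType) (n : nat) (ell : 'I_n -> R)
    (p : 'I_n -> R -> R) (x : 'I_n -> R) : Prop :=
  is_profile x /\
  forall y, is_profile y -> total_cost ell p x <= total_cost ell p y.

Definition phi_star_diag (R : realType) (n : nat) (ell : 'I_n -> R)
    (p : 'I_n -> R -> R) (xs : 'I_n -> R) (i : 'I_n) : R :=
  ell i + \sum_(k < n | (i < k)%N)
            (\prod_(j < n | (i < j <= k)%N) p j (xs j)) * ell k.

Definition phi_star (R : realType) (n : nat) (ell : 'I_n -> R)
    (p : 'I_n -> R -> R) (xs : 'I_n -> R) (i j : 'I_n) : R :=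
  if i == j then phi_star_diag ell p xs i
  else if (i < j)%N then (1 - p j (xs j)) * phi_star_diag ell p xs j
  else 0.

(* Main.v *)
(** As functions of agent k's own effort y, both the total cost and the agent's
    expected cost are a constant plus y - a * p_k(y): with P_k the product of
    the p_i(x_i) over i < k, the weight a is P_k * phi_star(k, k) for the former
    (at the efficient profile) and P_k * phi(k, k) for the latter.  Hence under
    phi_star the efficient profile is a Nash equilibrium; it is the only one
    because P_k depends on the efforts of the agents before k only and p_k is
    strictly concave.  Conversely the infinite slope of p_k at 0 makes efficient
    efforts positive, so the first-order condition a * p_k'(y) = 1 recovers a
    from y and forces phi(k, k) = phi_star(k, k); balance and independence then
    determine the off-diagonal liabilities. *)
Require Import Defs.
From mathcomp Require Import all_boot all_order all_algebra.
From mathcomp Require Import reals.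
From mathcomp Require Import boolp classical_sets topology normedtype derive.
From mathcomp Require Import zify ring lra.

Set Implicit Arguments.
Unset Strict Implicit.
Unset Printing Implicit Defensive.
Import Order.TTheory GRing.Theory Num.Theory.
Import numFieldNormedType.Exports.
Local Open Scope ring_scope.

(** * One-variable problem: minimizing y - a f(y) over y >= 0 *)

Definition minimizes (R : realType) (f : R -> R) (a x : R) : Prop :=
  0 <= x /\ forall y, 0 <= y -> x - a * f x <= y - a * f y.

(** If a = 0, comparison with 0 forces a minimizer to be 0. If a > 0, strict concavity would make
    the midpoint of two distinct minimizers strictly better than both. *)
Lemma minimizes_unique (R : realType) (f : R -> R) (a x y : R) :
  is_technology f -> 0 <= a -> minimizes f a x -> minimizes f a y -> x = y.
Proof.
move=> hf; rewrite le_eqVlt => /predU1P[<-|a0] [x0 hx] [y0 hy].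
  have := hx 0 (lexx 0); have := hy 0 (lexx 0); lra.
apply/eqP/negPn/negP => xy.
have h : 0 < (2^-1 : R) < 1 by lra.
have := tech_strictly_concave hf x0 y0 xy h.
have := hx (2^-1 * x + (1 - 2^-1) * y); have := hy x x0; have := hx y y0.
have -> : 0 <= 2^-1 * x + (1 - 2^-1) * y by lra.
move=> h1 h2 /(_ isT) h3 h4.
have : a * (2^-1 * f x + (1 - 2^-1) * f y) <
       a * f (2^-1 * x + (1 - 2^-1) * y) by rewrite ltr_pM2l.
lra.
Qed.

Lemma minimizes_gt0 (R : realType) (f : R -> R) (a x : R) :
  is_technology f -> 0 < a -> minimizes f a x -> 0 < x.
Proof.
move=> hf a0 [x0 hx]; rewrite lt_neqAle x0 andbT; apply/eqP => xE.
move: hx; rewrite -xE (tech_at0 hf) mulr0 subr0 => hx.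
(* Near 0 the slope of [f] exceeds 1/a, so by the mean value theorem a * f (e / 2) > e / 2, and the
   effort e / 2 beats 0. *)
have /cvgryPgt/(_ a^-1) := tech_derive_at0 hf.
rewrite /at_right near_withinE => /nbhs_ballP[e /= e0 he].
have [|||c] := @MVT R f (f^`()%classic) 0 (e / 2).
- lra.
- move=> y /[!in_itv]/= /andP[y0 _]; rewrite derive1E.
  exact/derivableP/tech_derivable.
- apply: continuous_subspaceW (tech_continuous hf).
  by move=> y /= /[!in_itv]/= /andP[].
rewrite in_itv /= (tech_at0 hf) !subr0 => /andP[c0 ce] fe.
have : a^-1 < f^`()%classic c.
  apply: he => //; rewrite /ball /= sub0r normrN gtr0_norm //; lra.
have := hx (e / 2); rewrite fe -(ltr_pM2l a0) divff ?gt_eqF //.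
have e2 : 0 < e / 2 by lra.
rewrite (ltW e2) => /(_ isT) h1; rewrite -(ltr_pM2r e2); lra.
Qed.

Lemma minimizes_foc (R : realType) (f : R -> R) (a x : R) :
  is_technology f -> 0 < x -> minimizes f a x -> a * f^`()%classic x = 1.
Proof.
move=> hf x0 [_ hx].
have df (y : R) : 0 < y -> is_derive y 1 (fun z : R => z - a * f z) (1 - a * f^`()%classic y).
  move=> y0; rewrite derive1E.
  have ? := derivableP (tech_derivable hf y0).
  by apply: is_derive_eq.
(* The bound [x + 1] only serves to make [x] interior to an open interval of admissible efforts. *)
have := @derive1_at_min R (fun z : R => z - a * f z) 0 (x + 1) x.
case=> [|y|||_].
- lra.
- by rewrite in_itv /= => /andP[/df[]].
- by rewrite in_itv /=; lra.
- by move=> y; rewrite in_itv /= => /andP[/ltW/hx].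
by case: (df x x0) => _ ->; lra.
Qed.

Lemma minimizes_equiv (R : realType) (c f : R -> R) (K a y : R) :
  (forall z, c z = K + (z - a * f z)) ->
  minimizes f a y <-> 0 <= y /\ forall z, 0 <= z -> c y <= c z.
Proof.
move=> cE; split=> -[y0 hy]; split=> // z z0.
  by rewrite !cE lerD2l hy.
by have := hy z z0; rewrite !cE lerD2l.
Qed.

(** * Costs as functions of one agent's own effort *)

Section Game.
Variables (R : realType) (n : nat) (p : 'I_n -> R -> R).
Implicit Types (x : 'I_n -> R) (phi : 'I_n -> 'I_n -> R) (k : 'I_n).

Definition upstream x k : R := \prod_(i < n | (i < k)%N) p i (x i).

Lemma expected_cost_own phi k x : exists K, forall y,
  expected_cost p phi k [eta x with k |-> y] =
  K + (y - upstream x k * phi k k * p k y).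
Proof.
exists (\sum_(j < n | (j < k)%N)
    (\prod_(i < n | (i < j)%N) p i (x i)) * (1 - p j (x j)) * phi j k
  + upstream x k * phi k k) => y.
have E (P : pred 'I_n) : (forall i, P i -> (i < k)%N) ->
    \prod_(i < n | P i) p i ([eta x with k |-> y] i) =
    \prod_(i < n | P i) p i (x i).
  move=> hP; apply: eq_bigr => i /hP ik /=; rewrite ifN //.
  by apply: contraTneq ik => ->; rewrite ltnn.
rewrite /expected_cost E //=.
rewrite (eq_bigr (fun j : 'I_n =>
    (\prod_(i < n | (i < j)%N) p i (x i)) * (1 - p j (x j)) * phi j k)).
  by rewrite eqxx /upstream; ring.
move=> j jk; rewrite E ?ifN //; last by move=> i ij; apply: ltn_trans ij jk.
by apply: contraTneq jk => ->; rewrite ltnn.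
Qed.

(** Only losses at j >= k involve [y]. Their success products split into the factors before k, the
    factor p_k(y) and those in (k, j]; the last, weighted by the losses, sum to [phi_star_diag]. *)
Lemma total_cost_own ell xs k : exists K, forall y,
  total_cost ell p [eta xs with k |-> y] =
  K + (y - upstream xs k * phi_star_diag ell p xs k * p k y).
Proof.
exists (\sum_(j < n) ell j
  - \sum_(j < n | (j < k)%N) (\prod_(i < n | (i <= j)%N) p i (xs i)) * ell j
  + \sum_(j < n | j != k) xs j) => y.
have E (P : pred 'I_n) : (forall i, P i -> i != k) ->
    \prod_(i < n | P i) p i (if i == k then y else xs i) =
    \prod_(i < n | P i) p i (xs i).
  by move=> hP; apply: eq_bigr => i /hP ik /=; rewrite ifN.
rewrite /total_cost [\sum_(j < n) [eta _ with _ |-> _] _](bigD1 k) //= eqxx.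
rewrite [\sum_(i < n | _) (if _ then _ else _)](eq_bigr xs); last first.
  by move=> i ik; rewrite ifN.
under eq_bigr do rewrite mulrBl mul1r.
rewrite sumrB [X in _ - X](bigID (fun j : 'I_n => (j < k)%N)) /=.
rewrite [X in _ - (X + _)](eq_bigr (fun j : 'I_n =>
    (\prod_(i < n | (i <= j)%N) p i (xs i)) * ell j)); last first.
  move=> j jk; rewrite E // => i ij.
  by apply: contraTneq (leq_ltn_trans ij jk) => ->; rewrite ltnn.
suff -> : \sum_(i < n | ~~ (i < k)%N)
     (\prod_(j < n | (j <= i)%N) p j (if j == k then y else xs j)) * ell i
   = upstream xs k * phi_star_diag ell p xs k * p k y by ring.
have F (j : 'I_n) : (k <= j)%N ->
   \prod_(i < n | (i <= j)%N) p i (if i == k then y else xs i) =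
   upstream xs k * (\prod_(i < n | (k < i <= j)%N) p i (xs i)) * p k y.
  move=> kj; rewrite (bigD1 k) //= eqxx [LHS]mulrC E; last by move=> i /andP[].
  congr (_ * _); rewrite (bigID (fun i : 'I_n => (i < k)%N)) /=.
  congr (_ * _); apply: eq_bigl => i; rewrite -val_eqE /=; lia.
rewrite (bigD1 k) /=; last by rewrite ltnn.
rewrite F // [X in upstream xs k * X]big1; last by move=> i; lia.
rewrite /phi_star_diag mulrDr mulrDl !mulr1; congr (_ + _); first by ring.
rewrite mulr_sumr mulr_suml; apply: eq_big => [j|j].
  by rewrite -val_eqE /=; lia.
by move=> /andP[kj _]; rewrite F 1?leqNgt //; ring.
Qed.

Lemma with_self x k : [eta x with k |-> x k] = x :> ('I_n -> R).
Proof. by apply/funext => i /=; case: eqP => // ->. Qed.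

(** Equilibrium splits into one-variable problems, coupled only through [upstream]. *)
Lemma is_nashP phi x : is_nash p phi x <->
  forall k, minimizes (p k) (upstream x k * phi k k) (x k).
Proof.
split=> [[x0 hx] k|hx].
  have [K /minimizes_equiv->] := expected_cost_own phi k x.
  by split=> // y y0; rewrite with_self hx.
split=> [k|k y y0]; first by case: (hx k).
have [K /minimizes_equiv E] := expected_cost_own phi k x.
by have [_ /(_ y y0)] := (E _).1 (hx k); rewrite with_self.
Qed.

Lemma is_efficient_minimizes ell xs k : is_efficient ell p xs ->
  minimizes (p k) (upstream xs k * phi_star_diag ell p xs k) (xs k).
Proof.
move=> [x0 hx]; have [K /minimizes_equiv->] := total_cost_own ell xs k.
split=> // y y0; rewrite with_self hx // => i /=.
by case: eqP.
Qed.

Hypothesis hp : forall i, is_technology (p i).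

Lemma upstream_ge0 x k : is_profile x -> 0 <= upstream x k.
Proof.
by move=> x0; apply: prodr_ge0 => i _; case/andP: (tech_range (hp i) (x0 i)).
Qed.

Lemma tech_gt0 i y : 0 < y -> 0 < p i y.
Proof. by move=> /(tech_increasing (hp i) (lexx 0)); rewrite (tech_at0 (hp i)). Qed.

Lemma ord_strong_ind (P : 'I_n -> Prop) :
  (forall k, (forall i : 'I_n, (i < k)%N -> P i) -> P k) -> forall k, P k.
Proof.
move=> IH k; have [m] := ubnP (k : nat); elim: m k => // m IHm k km.
by apply: IH => i ik; apply: IHm; lia.
Qed.

(** Strong induction on the agents: once earlier efforts agree, agent k faces the same weight in
    both equilibria. *)
Lemma nash_unique phi x y : (forall k, 0 <= phi k k) ->
  is_nash p phi x -> is_nash p phi y -> x = y.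
Proof.
move=> phi0 hx hy; apply/funext; apply: ord_strong_ind => k IH.
apply: (minimizes_unique (hp k) _ ((is_nashP phi x).1 hx k)).
  by rewrite mulr_ge0 ?phi0 ?upstream_ge0 //; case: hx.
have -> : upstream x k = upstream y k by apply: eq_bigr => i /IH ->.
exact: (is_nashP phi y).1.
Qed.

(** * Balance and independence of [phi_star] *)

Section Star.
Variables (ell xs : 'I_n -> R).
Hypotheses (ell0 : forall i, 0 < ell i) (xs0 : is_profile xs).

Local Notation D := (phi_star_diag ell p xs).

Lemma phi_star_diag_gt0 k : 0 < D k.
Proof.
rewrite ltr_wpDr //; apply: sumr_ge0 => i _; rewrite mulr_ge0 ?(ltW (ell0 i)) //.
by apply: prodr_ge0 => j _; case/andP: (tech_range (hp j) (xs0 j)).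
Qed.

Lemma phi_star_diag_succ (i i' : 'I_n) : i' = i.+1 :> nat ->
  D i = ell i + p i' (xs i') * D i'.
Proof.
move=> ii'; rewrite /phi_star_diag; congr (_ + _).
rewrite (bigD1 i') /=; last by lia.
rewrite mulrDr; congr (_ + _).
  congr (_ * _); rewrite (big_pred1 i') // => j; rewrite /= -val_eqE /=; lia.
rewrite mulr_sumr; apply: eq_big => [k|k /andP[ik ki']].
  by rewrite -val_eqE /=; lia.
rewrite mulrA; congr (_ * _); rewrite (bigD1 i') /=; last by lia.
by congr (_ * _); apply: eq_bigl => j; rewrite -val_eqE /=; lia.
Qed.

Lemma phi_star_diag_last (i : 'I_n) : n = i.+1 -> D i = ell i.
Proof.
by move=> ni; rewrite /phi_star_diag big1 ?addr0 // => k; have := ltn_ord k; lia.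
Qed.

Lemma phi_star_is_solution : is_solution ell (phi_star ell p xs).
Proof.
have D0 k : 0 <= D k by rewrite ltW ?phi_star_diag_gt0.
have q0 k : 0 <= 1 - p k (xs k) by have := tech_range (hp k) (xs0 k); lra.
split=> [i j|i j ji|i].
- rewrite /phi_star; case: ifP => // _; case: ifP => // _.
  exact: mulr_ge0.
- by rewrite /phi_star -val_eqE /= gtn_eqF // ltnNge ltnW.
have tail (F : 'I_n -> R) (k : 'I_n) :
    \sum_(j < n | (k <= j)%N) F j = F k + \sum_(j < n | (k < j)%N) F j.
  rewrite (bigD1 k) //=; congr (_ + _); apply: eq_bigl => j.
  by rewrite -val_eqE /=; lia.
have star_tail k : \sum_(j < n | (k < j)%N) phi_star ell p xs k j =
    \sum_(j < n | (k < j)%N) (1 - p j (xs j)) * D j.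
  by apply: eq_bigr => j kj; rewrite /phi_star kj -val_eqE /= ltn_eqF.
rewrite !tail star_tail {1}/phi_star eqxx.
(* Balance is proved from the last agent backwards: by the recursion for [D], the share p D of the
   next agent's diagonal in [D i] and the liability (1 - p) D add up to that diagonal. *)
have [m] := ubnP (n - i)%N; elim: m i => // m IH i nim.
have [ni|ni] := ltnP i.+1 n; last first.
  rewrite phi_star_diag_last; last by have := ltn_ord i; lia.
  by rewrite !big1 // => j; have := ltn_ord j; lia.
rewrite (@phi_star_diag_succ i (Ordinal ni)) //.
have tailS F := tail F (Ordinal ni).
rewrite !tailS -IH /=; last by lia.
ring.
Qed.

Lemma phi_star_independent :
  independent_indirect_liabilities (phi_star ell p xs).
Proof.
move=> i j k ij jk; have ik := ltn_trans ij jk.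
by rewrite /phi_star jk ik -!val_eqE /= !ltn_eqF.
Qed.

End Star.

(** Balance and the diagonal fix each row's sum beyond the diagonal. Rows k - 1 and k agree beyond
    column k, so subtracting their sums isolates the entry at (k - 1, k), which by independence is
    the whole column k above the diagonal. *)
Lemma independent_solution_unique ell phi psi :
  is_solution ell phi -> is_solution ell psi ->
  independent_indirect_liabilities phi ->
  independent_indirect_liabilities psi ->
  (forall i, phi i i = psi i i) -> phi = psi.
Proof.
move=> hphi hpsi iphi ipsi dE.
have tailE (i : 'I_n) : \sum_(j < n | (i < j)%N) phi i j =
                        \sum_(j < n | (i < j)%N) psi i j.
  have := etrans (solution_balance hphi i) (esym (solution_balance hpsi i)).
  rewrite (bigD1 i) //= [RHS](bigD1 i) //= dE => /addrI.
  have E : (fun j : 'I_n => (i <= j)%N && (j != i)) =1 (fun j => (i < j)%N).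
    by move=> j; rewrite -val_eqE /=; lia.
  by rewrite !(eq_bigl _ _ E).
apply/funext => i; apply/funext => k.
have [ik|ki|/val_inj-> //] := ltngtP i k; last first.
  by rewrite (solution_upstream hphi) ?(solution_upstream hpsi).
have [m mk] : exists m : 'I_n, k = m.+1 :> nat.
  have kn : (k.-1 < n)%N by have := ltn_ord k; lia.
  by exists (Ordinal kn) => /=; lia.
suff mE : phi m k = psi m k.
  have [im|mi] := ltnP i m; first by rewrite (iphi i m) ?(ipsi i m) ?mE ?mk.
  by have -> : i = m by apply: val_inj => /=; lia.
have tailm chi : independent_indirect_liabilities chi ->
    \sum_(j < n | (m < j)%N) chi m j =
    chi m k + \sum_(j < n | (k < j)%N) chi k j.
  move=> ichi; rewrite (bigD1 k) /=; last by lia.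
  congr (_ + _); apply: eq_big => [j|j /andP[mj jk]].
    by rewrite -val_eqE /=; lia.
  by apply: ichi; first lia; move: jk; rewrite -val_eqE /=; lia.
by have := tailE m; rewrite !tailm // tailE => /addIr.
Qed.

(** Induction is needed because the weight in agent k's problem is positive only once all earlier
    efforts are. *)
Lemma efficient_gt0 ell xs : (forall i, 0 < ell i) ->
  is_efficient ell p xs -> forall k, 0 < xs k.
Proof.
move=> ell0 hxs; apply: ord_strong_ind => k IH.
apply: (minimizes_gt0 (hp k) _ (is_efficient_minimizes k hxs)).
rewrite mulr_gt0 ?phi_star_diag_gt0 //; last by case: hxs.
by apply: prodr_gt0 => i ik; apply/tech_gt0/IH.
Qed.

End Game.

Theorem proposition4 (R : realType) (n : nat)
    (ell : 'I_n -> R) (p : 'I_n -> R -> R) (xs : 'I_n -> R)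
    (hproblem : is_problem ell p) (hxs : is_efficient ell p xs) :
  is_solution ell (phi_star ell p xs) /\
  forall phi : 'I_n -> 'I_n -> R, is_solution ell phi ->
    (independent_indirect_liabilities phi /\ implements p phi xs
     <-> phi = phi_star ell p xs).
Proof.
have [ell0 hp] := hproblem; have [xs0 _] := hxs.
have star := phi_star_is_solution hp ell0 xs0.
have starD k : phi_star ell p xs k k = phi_star_diag ell p xs k.
  by rewrite /phi_star eqxx.
have indep := @phi_star_independent _ _ p ell xs.
split=> // phi hphi; split=> [[iphi [/is_nashP nash _]]|->].
  apply: independent_solution_unique hphi star iphi indep _ => k.
  rewrite starD.
  (* Both weights solve a * p_k'(xs k) = 1 at the same point; cancelling the nonzero derivative and
     [upstream] equates the diagonals. *)
  have xk0 := efficient_gt0 hp ell0 hxs k.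
  have foc := minimizes_foc (hp k) xk0.
  have e1 := foc _ (nash k).
  have e2 := foc _ (is_efficient_minimizes k hxs).
  have P0 : 0 < upstream p xs k.
    by apply: prodr_gt0 => i _; apply/tech_gt0/(efficient_gt0 hp ell0 hxs).
  have d0 : (p k)^`()%classic (xs k) != 0.
    by apply/eqP => d0; move: e2; rewrite d0 mulr0 => /esym/eqP; rewrite oner_eq0.
  by apply: (mulfI (lt0r_neq0 P0)); apply: (mulIf d0); rewrite e1 e2.
have nash : is_nash p (phi_star ell p xs) xs.
  by apply/is_nashP => k; rewrite starD; apply: is_efficient_minimizes.
split; [exact: indep|split=> // y].
by apply: nash_unique => // k; apply: solution_ge0 star _ _.
Qed.
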